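(* Let $0\le p<1$. There is no fixed-query method for which there exists a constant $C>0$ such that, for all $L>0$, $D>0$, $\sigma\ge0$, $L_\Delta\ge0$, every admissible instance with parameters $(L,D,\sigma,L_\Delta)$, and every integer $N\ge2$, the output $\widehat z_N$ of the method after $N$ iterations satisfies $$\mathbb E[\mathcal R(\widehat z_N)^2]\le C\left(\frac{L^2D^2}{N^2}+\frac{\sigma^2\log^pN}{N}\right).$$
   Context: An admissible instance with parameters $(L,D,\sigma,L_\Delta)$ consists of: a real Hilbert space $\mathcal H$; a monotone, $L$-Lipschitz operator $F:\mathcal H\to\mathcal H$; a maximally monotone $A:\mathcal H\rightrightarrows\mathcal H$; an initial point $z_0$ such that some $z_\star$ with $0\in F(z_\star)+A(z_\star)$ satisfies $\|z_0-z_\star\|\le D$; and a distribution of random operators $F_\xi=F+\delta_\xi$ with, for all $x,y,z\in\mathcal H$, $\mathbb E[\delta_\xi(z)]=0$, $\mathbb E\|\delta_\xi(z)\|^2\le\sigma^2$, and $\mathbb E\|\delta_\xi(x)-\delta_\xi(y)\|^2\le L_\Delta^2\|x-y\|^2$. The residual is $\mathcal R(z)=\operatorname{dist}(0,F(z)+A(z))$. A method is an iterative adaptive randomized algorithm (which may depend on $N$ and the parameters, knows $z_0$, and has exact access to the resolvents $J_{\alpha A}=(I+\alpha A)^{-1}$, $\alpha>0$) that accesses $F$ only through oracle queries: at each query it chooses a point $z$ and either a fresh independent sampled operator or any previously sampled operator, based on its internal randomness and all previous observations, and observes the value $F_\xi(z)$ of that sampled operator. Each evaluation $F_\xi(z)$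 counts as one oracle query. A method is fixed-query if there is a constant $r$, depending only on the method, such that every iteration uses at most $r$ oracle queries, uniformly over all admissible instances, iteration indices, total numbers of iterations (horizons), and target accuracies. *)

(* Defs.v *)
From HB Require Import structures.
From mathcomp Require Import all_boot all_order all_algebra sesquilinear.
From mathcomp Require Import all_classical all_reals all_analysis.
Import Order.TTheory GRing.Theory Num.Theory numFieldNormedType.Exports.

Set Implicit Arguments.
Unset Strict Implicit.
Unset Printing Implicit Defensive.

Local Open Scope classical_set_scope.
Local Open Scope ring_scope.

(** * Real Hilbert spaces: complete normed spaces whose norm comes from an
    inner product *)

Record hilbert (R : realType) := Hilbert {
  carrier :> completeNormedModType R;
  inner : {dot carrier for idfun};
  inner_norm : forall x : carrier, inner x x = `|x| ^+ 2 }.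

Arguments inner {R h}.

(** * Operators *)

Section operators.
Context {R : realType} {H : hilbert R}.
Implicit Types (F : H -> H) (A : H -> set H).

Definition monotone F := forall x y, 0 <= inner (F x - F y) (x - y).

Definition monotone_set A :=
  forall x y u v, A x u -> A y v -> 0 <= inner (u - v) (x - y).

Definition maximally_monotone A :=
  monotone_set A /\
  forall B : H -> set H, monotone_set B -> (forall x, A x `<=` B x) ->
    forall x, B x `<=` A x.

(* [get] picks the value: when A is maximally monotone, exactly one y
   satisfies z \in y + a A(y) (Minty) *)
Definition resolvent A (a : {posnum R}) (z : H) : H :=
  get [set y | exists2 v, A y v & z = y + a%:num *: v].

(* dist(0, F z + A z); it is +oo outside the domain of A *)
Definition residual F A (z : H) : \bar R :=
  ereal_inf [set `|F z + v|%:E | v in A z].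

End operators.

(** * Random vectors *)

Section random_vectors.
Context {R : realType} {H : hilbert R}.

(* Strong (Bochner) measurability: Borel, with separable range; unlike plain
   Borel measurability, it is stable under sums in a nonseparable H *)
Definition random_vector d (T : measurableType d) (X : T -> H) :=
  measurable_fun setT (X : T -> g_sigma_algebraType (@open H)) /\
  exists2 S : set H, countable S & range X `<=` closure S.

(* The expectation of X is the vector m with <h, m> = E <h, X> for all h *)
Definition is_expectation d (T : measurableType d) (P : probability T R)
    (X : T -> H) (m : H) :=
  forall h : H, P.-integrable setT (EFin \o (fun t => inner h (X t))) /\
    ('E_P[fun t => inner h (X t)] = (inner h m)%:E)%E.

End random_vectors.

(** * The law of n independent samples *)

Section iid.
Context d (T : measurableType d) {R : realType} (P : probability T R).

Definition consT n (x : T * n.-tuple T) : n.+1.-tuple T := [tuple of x.1 :: x.2].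

Lemma measurable_consT n : measurable_fun setT (@consT n).
Proof. exact: measurable_cons measurable_fst measurable_snd. Qed.

HB.instance Definition _ n :=
  isMeasurableFun.Build _ _ _ _ (@consT n) (@measurable_consT n).

Fixpoint iid n : probability (n.-tuple T) R :=
  if n is m.+1 then distribution (P \x iid m)%E (@consT m)
  else \d_[tuple].

End iid.

(** * Instances *)

Record instance (R : realType) (H : hilbert R) := Instance {
  op : H -> H;
  mop : H -> set H;
  start : H;
  sample_display : measure_display;
  sample : measurableType sample_display;
  sample_law : probability sample R;
  noise : sample -> H -> H }.

Section admissible.
Context {R : realType} {H : hilbert R}.

Definition oracle (I : instance H) (xi : sample I) (z : H) : H :=
  op I z + noise xi z.

(* Joint measurability of the noise: its value at a random point is random.
   Adaptively chosen queries need this; for constant points it says that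
   each noise(z) is a random vector, and for separable H it amounts to
   measurability of (xi, z) |-> noise xi z. *)
Definition jointly_measurable d (S : measurableType d) (f : S -> H -> H) :=
  forall d' (T : measurableType d') (Z : T -> H), random_vector Z ->
    random_vector (fun w : T * S => f w.2 (Z w.1)).

Definition admissible (L D sigma LDelta : R) (I : instance H) : Prop :=
  [/\ [/\ 0 < L, 0 < D, 0 <= sigma & 0 <= LDelta],
      monotone (op I) /\ L.-lipschitz (op I),
      maximally_monotone (mop I),
      exists zs, (exists2 v, mop I zs v & op I zs + v = 0) /\
                 `|start I - zs| <= D &
   [/\ jointly_measurable (@noise _ _ I),
       forall z, is_expectation (sample_law I) ((@noise _ _ I)^~ z) 0,
       forall z, ('E_(sample_law I)[fun xi => (`|noise xi z| ^+ 2)%R] <=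
                   (sigma ^+ 2)%:E)%E &
       forall x y, ('E_(sample_law I)[fun xi =>
                       (`|noise xi x - noise xi y| ^+ 2)%R] <=
                     (LDelta ^+ 2 * `|x - y| ^+ 2)%:E)%E]].

End admissible.

(** * Methods *)

Record observation (H : Type) := Observation {
  sample_id : nat; query_point : H; query_value : H }.

(* [sampled] operators, numbered from 0 in the order of their first use, have
   been drawn so far; [past] holds the observations of each completed
   iteration and [current] those of the iteration in progress. *)
Record state (H : Type) := State {
  sampled : nat; past : seq (seq (observation H));
  current : seq (observation H) }.

(* [Query i z] evaluates sampled operator number i at z if i < [sampled], and
   a fresh independent one otherwise. *)
Variant action (H : Type) := Query of nat & H | EndIteration.
Arguments EndIteration {H}.

Record algorithm (R : realType) (H : hilbert R) := Algorithm {
  seed_display : measure_display;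
  seed : measurableType seed_display;
  seed_law : probability seed R;
  decide : seed -> state H -> action H;
  answer : seed -> state H -> H }.

(* The arguments are the space, the parameters L, D, sigma, LDelta, the number
   N of iterations, the initial point, and the resolvents of A. *)
Definition method (R : realType) :=
  forall H : hilbert R, R -> R -> R -> R -> nat -> H ->
    ({posnum R} -> H -> H) -> algorithm H.

Section run.
Context {R : realType} {H : hilbert R}.
Variables (a : algorithm H) (N : nat) (I : instance H).

Definition step (u : seed a) (xis : seq (sample I)) (s : state H) : state H :=
  if size (past s) == N then s else
  match decide u s with
  | Query i z =>
      let j := minn i (sampled s) in
      State (maxn (sampled s) j.+1) (past s)
        (rcons (current s)
           (Observation j z (oracle (nth point xis j) z)))
  | EndIteration => State (sampled s) (rcons (past s) (current s)) [::]
  end.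

(* State after n steps; these draw at most n operators. *)
Definition run n (w : seed a * n.-tuple (sample I)) : state H :=
  iter n (step w.1 w.2) (State 0 [::] [::]).

Definition output n (w : seed a * n.-tuple (sample I)) : H :=
  answer w.1 (run w).

Definition mean_sq_residual n : \bar R :=
  (\int[seed_law a \x iid (sample_law I) n]_w
     residual (op I) (mop I) (output w) ^+ 2)%E.

End run.

Section method_properties.
Context {R : realType} (M : method R).

Definition instantiate (H : hilbert R) (I : instance H) L D sigma LDelta N :
    algorithm H :=
  M L D sigma LDelta N (start I) (resolvent (mop I)).

(* Needed for the expectations to make sense *)
Definition measurable_method :=
  forall L D sigma LDelta (H : hilbert R) (I : instance H),
    admissible L D sigma LDelta I -> forall N n,
    random_vector
      (@output _ _ (instantiate I L D sigma LDelta N) N I n).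

Definition fixed_query (r : nat) :=
  forall L D sigma LDelta (H : hilbert R) (I : instance H),
    admissible L D sigma LDelta I ->
    forall N n (w : seed (instantiate I L D sigma LDelta N)
                    * n.-tuple (sample I)),
    (size (current (run N w)) <= r)%N.

End method_properties.

(* Main.v *)
From HB Require Import structures.
Require Import Defs.
From mathcomp Require Import all_boot all_order all_algebra.
From mathcomp Require Import all_classical all_reals all_analysis.
From mathcomp Require Import sesquilinear measurable_realfun ring lra.
Import Order.TTheory GRing.Theory Num.Theory numFieldNormedType.Exports.

Set Implicit Arguments.
Unset Strict Implicit.
Unset Printing Implicit Defensive.

Local Open Scope ring_scope.

(* Noisy binary search on the real line, with A = 0. A sampled operator
   interpolates between independent random values +s or -s at the integers
   0, ..., M, so that one evaluation reveals at most two random bits, even if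
   old samples are queried again. Under hypothesis k < M, the value at j has
   mean -1 for j <= k and 1 for j > k: the mean operator F_k has residual 1
   outside the cell (k, k+1), and no answer is good for two hypotheses.
   Relative to unbiased bits, each bit has chi-square divergence s^-2, hence n
   adaptively read bits give (E_k g)^2 <= (1 + s^-2)^n E g^2. Applied to the
   indicators of the M cells and summed over k, this shows that the average
   over k of the mean squared residual is at least 1/2 as long as
   (1 + s^-2)^n <= M / 4. With s^2 proportional to N / ln N and M proportional
   to N, this holds for n = O(N), while the claimed upper bound, in which
   L = 2, D = M and sigma = 2 s, is O(M^2 / N^2 + (ln N)^(p - 1)). *)

(** * Adaptive reading of independent coordinates *)

Section product_weights.
Context {R : realFieldType} {V B : finType}.
Implicit Types (w : V -> B -> R) (f g : {ffun V -> B} -> R).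

Definition prodw w (x : {ffun V -> B}) : R := \prod_v w v (x v).

Definition wsum w f : R := \sum_x prodw w x * f x.

(** Conditioning on the value [b] at coordinate [v]. The coordinate stays in place as a point mass,
    so that reading it again needs no separate treatment. *)
Definition freeze w v b : V -> B -> R :=
  fun u c => if u == v then (c == b)%:R else w u c.

Lemma prodw_freeze w v b x :
  prodw (freeze w v b) x = (x v == b)%:R * \prod_(u | u != v) w u (x u).
Proof.
rewrite /prodw (bigD1 v)//= /freeze eqxx; congr (_ * _).
by apply: eq_bigr => u /negbTE ->.
Qed.

(** The law of total expectation with respect to coordinate [v]. *)
Lemma wsum_freeze w v f :
  wsum w f = \sum_b w v b * wsum (freeze w v b) f.
Proof.
rewrite /wsum; under [RHS]eq_bigr do rewrite mulr_sumr.
rewrite exchange_big/=; apply: eq_bigr => x _.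
rewrite (bigD1 (x v))//= big1 => [|b bx]; last first.
  by rewrite prodw_freeze eq_sym (negbTE bx) !(mul0r, mulr0).
by rewrite addr0 prodw_freeze eqxx mul1r mulrA /prodw (bigD1 v).
Qed.

Lemma eq_wsum_freeze w v b f g :
  (forall x : {ffun V -> B}, x v = b -> f x = g x) ->
  wsum (freeze w v b) f = wsum (freeze w v b) g.
Proof.
move=> fg; apply: eq_bigr => x _.
rewrite prodw_freeze; have [/fg ->//|_] := eqVneq (x v) b.
by rewrite !mul0r.
Qed.

Lemma sum_prodw w : (forall v, \sum_b w v b = 1) -> \sum_x prodw w x = 1.
Proof. by move=> w1; rewrite /prodw -bigA_distr_bigA/= big1. Qed.

Lemma prodw_ge0 w x : (forall v b, 0 <= w v b) -> 0 <= prodw w x.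
Proof. by move=> w0; apply: prodr_ge0. Qed.

Lemma sum_prodw_le w f (c : R) : (forall v b, 0 <= w v b) ->
    (forall v, \sum_b w v b = 1) -> (forall x, f x <= c) ->
  \sum_x prodw w x * f x <= c.
Proof.
move=> w0 w1 fc; apply: (@le_trans _ _ (\sum_x prodw w x * c)).
  by apply: ler_sum => x _; rewrite ler_wpM2l// prodw_ge0.
by rewrite -mulr_suml sum_prodw// mul1r.
Qed.

(* [reads n f]: the value of f is found by adaptively reading at most n
   coordinates of its argument, with repetitions allowed. *)
Fixpoint reads n f : Prop :=
  if n is n'.+1 then
    exists v (F : B -> {ffun V -> B} -> R),
      (forall b, reads n' (F b)) /\ forall x, f x = F (x v) x
  else exists c, forall x, f x = c.

(* For weights w and nonnegative weights w' of total mass 1, the last inequality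
   says that w has chi-square divergence at most kappa - 1 from w'. *)
Definition chi2_le kappa w w' := forall v,
  [/\ \sum_b w v b = 1, \sum_b w' v b = 1, forall b, 0 <= w' v b &
      forall h : B -> R,
        (\sum_b w v b * h b) ^+ 2 <= kappa * \sum_b w' v b * h b ^+ 2].

Lemma sum_pointw (b : B) (h : B -> R) : \sum_c (c == b)%:R * h c = h b.
Proof.
rewrite (bigD1 b)//= eqxx mul1r big1 ?addr0// => c /negbTE ->.
by rewrite mul0r.
Qed.

(** A frozen coordinate is the same point mass under both weights, so there any factor [kappa] that
    is at least 1 will do. *)
Lemma chi2_le_freeze kappa w w' v b : 1 <= kappa ->
  chi2_le kappa w w' -> chi2_le kappa (freeze w v b) (freeze w' v b).
Proof.
move=> k1 ww' u; rewrite /freeze; case: eqP => [_|_]; last exact: ww'.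
have s1 : \sum_c (c == b)%:R = 1 :> R.
  by under eq_bigr do rewrite -[_%:R]mulr1; rewrite sum_pointw.
by split => // h; rewrite !sum_pointw ler_peMl ?sqr_ge0.
Qed.

(** Induction on the reads: after conditioning on the first coordinate read, the one-coordinate
    inequality is applied to the conditional expectations of [f]. Each read costs one factor
    [kappa]. *)
Lemma chi2_le_reads kappa n f w w' : 1 <= kappa -> chi2_le kappa w w' ->
  reads n f ->
  wsum w f ^+ 2 <= kappa ^+ n * wsum w' (fun x => f x ^+ 2).
Proof.
move=> k1; have k0 : 0 <= kappa by exact: le_trans k1.
elim: n f w w' => [|n IHn] f w w' ww' /=.
  move=> [c fc]; rewrite /wsum; under eq_bigr do rewrite fc.
  under [in leRHS]eq_bigr do rewrite fc.
  rewrite -!mulr_suml !sum_prodw ?expr0 ?mul1r// => v; by have [] := ww' v.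
move=> [v [F [rF fF]]].
rewrite (wsum_freeze w v) (wsum_freeze w' v).
have [_ _ w'0 /(_ (fun b => wsum (freeze w v b) f)) h] := ww' v.
apply: le_trans h _; rewrite [kappa ^+ _]exprS -mulrA ler_wpM2l// mulr_sumr.
apply: ler_sum => b _; rewrite [leRHS]mulrCA ler_wpM2l//.
rewrite (@eq_wsum_freeze w v b f (F b)); last by move=> x xb; rewrite fF xb.
rewrite (@eq_wsum_freeze w' v b _ (fun x => F b x ^+ 2)); last first.
  by move=> x xb; rewrite fF xb.
exact: IHn (chi2_le_freeze _ _ k1 ww') (rF b).
Qed.

(** Two reads per step, because an oracle value interpolates between two nodes. *)
Lemma reads_iter (S : Type) (next : {ffun V -> B} -> S -> S) (h : S -> R) :
  (forall s, exists v1 v2 (G : B -> B -> S),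
     forall x, next x s = G (x v1) (x v2)) ->
  forall n s, reads n.*2 (fun x => h (iter n (next x) s)).
Proof.
move=> nextP; elim => [|n IHn] s; first by exists (h s).
have [v1 [v2 [G nextG]]] := nextP s.
exists v1, (fun b1 x => h (iter n (next x) (G b1 (x v2)))); split => [b1|x].
  by exists v2, (fun b2 x => h (iter n (next x) (G b1 b2))).
by rewrite iterSr nextG.
Qed.

End product_weights.

(** * Biased bits and mutually exclusive hypotheses *)

Definition bias {R : realFieldType} (a : R) (b : bool) : R :=
  (1 + (if b then a else - a)) / 2.

Lemma sum_bias (R : realFieldType) (a : R) : \sum_b bias a b = 1.
Proof. by rewrite big_bool /bias/=; field. Qed.

Lemma bias_ge0 (R : realFieldType) (a : R) b : -1 <= a <= 1 -> 0 <= bias a b.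
Proof. by rewrite /bias => a1; case: b; lra. Qed.

(** Cauchy-Schwarz against the fair coin: the sum over the two values of the squared weight divided
    by 1/2 is 1 + a^2. The defect is exhibited as an explicit square. *)
Lemma chi2_le_bias (R : realFieldType) (V : finType) (a : V -> R) (e : R) :
  (forall v, a v ^+ 2 = e) ->
  chi2_le (1 + e) (fun v => bias (a v)) (fun=> bias 0).
Proof.
move=> ae v; split; rewrite ?sum_bias//.
  by move=> b; apply: bias_ge0; lra.
move=> h; rewrite !big_bool /bias/= -(ae v).
rewrite oppr0 addr0 -subr_ge0.
have -> : (1 + a v ^+ 2) * (1 / 2 * h true ^+ 2 + 1 / 2 * h false ^+ 2) -
  ((1 + a v) / 2 * h true + (1 - a v) / 2 * h false) ^+ 2 =
  (((1 + a v) * h false - (1 - a v) * h true) / 2) ^+ 2 by field.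
exact: sqr_ge0.
Qed.

(* If each hypothesis k is close to a common reference measure, an algorithm
   cannot locate all of them: here [g k x] is 1 when the answer on input x is
   acceptable under k, and no answer is acceptable under two hypotheses. *)
Lemma exclusive_hypotheses (R : realFieldType) (V B : finType) M n (kappa : R)
    (w : 'I_M -> V -> B -> R) (w' : V -> B -> R)
    (g : 'I_M -> {ffun V -> B} -> R) :
  1 <= kappa -> (forall k, chi2_le kappa (w k) w') ->
  (forall k, reads n (g k)) ->
  (forall k x, g k x ^+ 2 = g k x) -> (forall x, \sum_k g k x <= 1) ->
  kappa ^+ n <= M%:R / 4 ->
  M%:R / 2 <= \sum_k wsum (w k) (fun x => 1 - g k x).
Proof.
case: M => [|M] in w g *; first by move=> *; rewrite big_ord0 mul0r.
move=> k1 ww' rg g2 g1 kM.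
have E k : wsum (w k) (fun x => 1 - g k x) = 1 - wsum (w k) (g k).
  rewrite /wsum; under eq_bigr do rewrite mulrBr mulr1.
  by rewrite sumrB sum_prodw// => v; have [] := ww' k v.
have w'1 v : \sum_b w' v b = 1 by have [] := ww' ord0 v.
have w'0 v b : 0 <= w' v b by have [_ _ /(_ b)] := ww' ord0 v.
have Q : \sum_k wsum w' (g k) <= 1.
  rewrite /wsum exchange_big/= -(sum_prodw w'1); apply: ler_sum => x _.
  by rewrite -mulr_sumr ler_piMr// prodw_ge0.
(* As [g] equals its square, the second moments under [w'] are means, and these sum to at most 1 by
   [Q]. *)
have P2 : \sum_k wsum (w k) (g k) ^+ 2 <= M.+1%:R / 4.
  have S : \sum_k wsum (w k) (g k) ^+ 2 <= kappa ^+ n * \sum_k wsum w' (g k).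
    rewrite mulr_sumr; apply: ler_sum => k _.
    apply: le_trans (chi2_le_reads k1 (ww' k) (rg k)) _.
    by under [X in _ * X]eq_bigr do rewrite g2.
  apply: (le_trans S); apply: (le_trans _ kM); apply: ler_piMr Q.
  by rewrite exprn_ge0// (le_trans _ k1).
(* From squares to first powers by t <= t^2 + 1/4 in each term. *)
have P1 : \sum_k wsum (w k) (g k) <= M.+1%:R / 4 + M.+1%:R / 4.
  apply: le_trans (lerD P2 (lexx _)).
  have -> : M.+1%:R / 4 = \sum_(k < M.+1) 4^-1 :> R.
    by rewrite sumr_const card_ord mulr_natl.
  rewrite -big_split/=.
  apply: ler_sum => k _; rewrite -subr_ge0.
  have -> : wsum (w k) (g k) ^+ 2 + 4^-1 - wsum (w k) (g k) =
    (wsum (w k) (g k) - 2^-1) ^+ 2 by field.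
  exact: sqr_ge0.
under eq_bigr do rewrite E.
by rewrite sumrB sumr_const card_ord -[1 *+ M.+1]/(M.+1%:R : R); lra.
Qed.

(** * Interpolation between integers *)

Section interpolation.
Context {R : realFieldType}.
Implicit Types (c : nat -> R) (z : R).

Definition ramp (i : nat) z : R := Num.min (Num.max (z - i%:R) 0) 1.

(* The piecewise linear function with value [c i] at [i], for i <= M, which is
   constant to the left of 0 and to the right of M. *)
Definition interp M c z : R := c 0 + \sum_(i < M) (c i.+1 - c i) * ramp i z.

Lemma ramp0 i z : z <= i%:R -> ramp i z = 0.
Proof.
by move=> zi; rewrite /ramp (max_idPr _) ?subr_le0// (min_idPl _).
Qed.

Lemma ramp1 i z : i.+1%:R <= z -> ramp i z = 1.
Proof.
rewrite -natr1 => iz; rewrite /ramp (max_idPl _); last by lra.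
by rewrite (min_idPr _)//; lra.
Qed.

Lemma ramp_mid i z : i%:R <= z <= i.+1%:R -> ramp i z = z - i%:R.
Proof.
rewrite -natr1 => iz; rewrite /ramp (max_idPl _); last by lra.
by rewrite (min_idPl _)//; lra.
Qed.

Variant ramp_spec (i : nat) z : R -> Type :=
| RampLeft of z - i%:R <= 0 : ramp_spec i z 0
| RampMid of 0 <= z - i%:R <= 1 : ramp_spec i z (z - i%:R)
| RampRight of 1 <= z - i%:R : ramp_spec i z 1.

Lemma rampP i z : ramp_spec i z (ramp i z).
Proof.
have [zi|iz] := leP z i%:R; first by rewrite ramp0//; constructor; lra.
have [zi|iz1] := leP z i.+1%:R.
  by rewrite ramp_mid ?zi ?ltW//; constructor; move: zi; rewrite -natr1; lra.
by rewrite ramp1 ?ltW//; constructor; move: iz1; rewrite -natr1; lra.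
Qed.

Lemma ramp_itv i z : 0 <= ramp i z <= 1.
Proof. by case: rampP; lra. Qed.

Lemma ramp_nondecreasing i x y : x <= y -> ramp i x <= ramp i y.
Proof. by case: (rampP i x); case: (rampP i y); lra. Qed.

Lemma ramp_monotone i x y : 0 <= (ramp i x - ramp i y) * (x - y).
Proof.
have [xy|/ltW yx] := leP x y.
  by rewrite mulr_le0// subr_le0 // ramp_nondecreasing.
by rewrite mulr_ge0// subr_ge0 // ramp_nondecreasing.
Qed.

Lemma ramp_lipschitz i x y : `|ramp i x - ramp i y| <= `|x - y|.
Proof.
wlog xy : x y / y <= x.
  by move=> h; have [/h//|/ltW/h] := leP y x; rewrite distrC (distrC x).
rewrite !ger0_norm ?subr_ge0 ?ramp_nondecreasing//.
by case: (rampP i x); case: (rampP i y); lra.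
Qed.

(** The nodes and [t] are chosen before [c]: the query point alone decides which two bits are
    read. *)
Lemma interp_local M z : exists (i j : 'I_M.+1) (t : R),
  0 <= t <= 1 /\ forall c, interp M c z = (1 - t) * c i + t * c j.
Proof.
elim: M => [|M [i [j [t [t01 IH]]]]].
  exists ord0, ord0, 0; split; first by lra.
  by move=> c; rewrite /interp big_ord0/=; ring.
have E c : interp M.+1 c z = interp M c z + (c M.+1 - c M) * ramp M z.
  by rewrite /interp big_ord_recr/= addrA.
have [zM|Mz] := leP z M%:R.
  exists (widen_ord (leqnSn _) i), (widen_ord (leqnSn _) j), t; split => // c.
  by rewrite E IH ramp0//= mulr0 addr0.
exists (inord M), ord_max, (ramp M z); split; first exact: ramp_itv.
move=> c; rewrite E inordK//=.
(* To the right of [M] all earlier ramps equal 1 and the sum telescopes. *)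
suff -> : interp M c z = c M by ring.
rewrite /interp.
under eq_bigr => k _.
  rewrite ramp1 ?mulr1; last by rewrite (le_trans _ (ltW Mz))// ler_nat.
  over.
by rewrite -(big_mkord xpredT (fun k => c k.+1 - c k)) telescope_sumr// subrKC.
Qed.

Lemma interpB M c c' z :
  interp M c z - interp M c' z = interp M (fun i => c i - c' i) z.
Proof.
rewrite /interp opprD addrACA; congr (_ + _); rewrite -sumrB.
by apply: eq_bigr => i _; ring.
Qed.

Lemma norm_interp M c z (s : R) : (forall i, `|c i| <= s) ->
  `|interp M c z| <= s.
Proof.
move=> cs; have [i [j [t [t01 ->]]]] := interp_local M z.
have := cs i; have := cs j; rewrite !ler_norml; nra.
Qed.

(** The crude factor [M] is harmless: it only enters [LDelta], which is absent from the bound to be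
    refuted. *)
Lemma interp_lipschitz M c (s : R) x y : (forall i, `|c i| <= s) ->
  `|interp M c x - interp M c y| <= (s *+ 2) *+ M * `|x - y|.
Proof.
move=> cs; rewrite /interp opprD addrACA subrr add0r -sumrB.
apply: le_trans (ler_norm_sum _ _ _) _.
have -> : s *+ 2 *+ M * `|x - y| = \sum_(i < M) s *+ 2 * `|x - y|.
  by rewrite sumr_const card_ord mulrnAl.
apply: ler_sum => i _.
rewrite -mulrBr normrM ler_pM ?ramp_lipschitz//.
by rewrite mulr2n (le_trans (ler_normB _ _))// lerD.
Qed.

End interpolation.

Lemma wsum_coord (R : realFieldType) (V B : finType) (w : V -> B -> R) v
    (h : B -> R) : (forall u, \sum_b w u b = 1) ->
  wsum w (fun x => h (x v)) = \sum_b w v b * h b.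
Proof.
move=> w1; rewrite (wsum_freeze w v); apply: eq_bigr => b _; congr (_ * _).
rewrite (@eq_wsum_freeze _ _ _ w v b _ (fun=> h b)); last by move=> x ->.
rewrite /wsum -mulr_suml sum_prodw ?mul1r// => u.
rewrite /freeze; case: eqP => // _.
by under eq_bigr do rewrite -[_%:R]mulr1; rewrite sum_pointw.
Qed.

Lemma sum_open_cells_le1 (R : realFieldType) M (z : R) :
  \sum_(k < M) (k%:R < z < k.+1%:R)%R%:R <= 1 :> R.
Proof.
have [k kz|nz] := pickP (fun k : 'I_M => k%:R < z < k.+1%:R); last first.
  by rewrite big1// => k _; rewrite nz.
rewrite (bigD1 k)//= kz big1 ?addr0// => l lk.
case: andP => // -[lz zl]; case/andP: kz => kz zk.
have := lt_trans lz zk; have := lt_trans kz zl; rewrite !ltr_nat !ltnS => kl lk'.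
by move: lk; rewrite -val_eqE/= eqn_leq kl lk'.
Qed.

(** * The real line and finitely supported laws *)

Section real_line.
Local Open Scope classical_set_scope.
Local Open Scope ring_scope.
Context (R : realType).

Definition mulR (x y : R) : R := x * y.

Lemma mulR_bilinear : bilinear_for *%R (idfun \; *%R : R -> R -> R) mulR.
Proof.
by split=> u c x y; rewrite /mulR /=; rewrite -?[c *: x]/(c * x); ring.
Qed.

HB.instance Definition _ := @bilinear_isBilinear.Build R R R R
  *%R (idfun \; *%R) mulR mulR_bilinear.

Lemma mulR_hermitian (x y : R) : mulR x y = (-1) ^+ false * idfun (mulR y x).
Proof. by rewrite /mulR expr0 mul1r mulrC. Qed.

HB.instance Definition _ :=
  @isHermitianSesquilinear.Build R R false idfun mulR mulR_hermitian.

Lemma mulR_gt0 (u : R) : u != 0 -> 0 < mulR u u.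
Proof. by move=> u0; rewrite /mulR -expr2 exprn_even_gt0. Qed.

HB.instance Definition _ := @isDotProduct.Build R R mulR mulR_gt0.

Lemma mulR_norm (x : R) : mulR x x = `|x| ^+ 2.
Proof. by rewrite /mulR -expr2 real_normK ?num_real. Qed.

Definition real_line : hilbert R := Hilbert mulR_norm.

(** Open sets generate the Borel sets of the line, and the rationals provide the countable dense
    set. *)
Lemma random_vector_real d (T : measurableType d) (X : T -> real_line) :
  random_vector X <-> measurable_fun setT (X : T -> R).
Proof.
split=> [[mX _]|mX].
  move=> mT; apply: (measurability _ (RGenOpens.measurableE R)) => //.
  move=> _ [_ [a [b ->]] <-].
  apply: mX => //; apply: sub_sigma_algebra.
  exact: interval_open.
split.
  apply: (@measurability _ _ T (g_sigma_algebraType (@open real_line)) setT X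
    (@open real_line)) => //.
  move=> _ [A oA <-]; apply: mX => //; exact: open_measurable.
exists (range (@ratr R)).
  by apply: (sub_countable (card_image_le _ _)); exact: countableP.
move=> x _ B; rewrite nbhsE => -[U [oU Ux] UB].
have [y [Uy ry]] := dense_rat (ex_intro _ x Ux) oU.
by exists y; split => //; exact: UB.
Qed.

End real_line.

Section finite_law.
Local Open Scope classical_set_scope.
Local Open Scope ring_scope.
Context d (T : measurableType d) (R : realType).
Variable s : seq ({nonneg R} * T).
Local Open Scope ereal_scope.

Let atom k := nth ((0%:nng)%R, point) s k.

Definition finite_measure_of :=
  msum (fun k => mscale (atom k).1 (dirac (atom k).2)) (size s).

HB.instance Definition _ := Measure.on finite_measure_of.

Lemma integral_finite_measure_of (f : T -> \bar R) : measurable_fun setT f ->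
  (forall t, 0 <= f t) ->
  \int[finite_measure_of]_t f t = \sum_(q <- s) q.1%:num%:E * f q.2.
Proof.
move=> mf f0; rewrite /finite_measure_of ge0_integral_measure_sum//.
rewrite (big_nth ((0%:nng)%R, point)) big_mkord; apply: eq_bigr => i _.
by rewrite ge0_integral_mscale//= integral_dirac//= diracT mul1e.
Qed.

Hypothesis s1 : (\sum_(q <- s) q.1%:num = 1)%R.

Lemma finite_measure_of_setT : finite_measure_of setT = 1.
Proof.
rewrite -[LHS]mul1e -integral_cst// integral_finite_measure_of//.
by under eq_bigr do rewrite mule1; rewrite sumEFin s1.
Qed.

Definition finite_law : probability T R :=
  HB.pack finite_measure_of (Measure_isProbability.Build _ _ _
    finite_measure_of finite_measure_of_setT).

End finite_law.

Section finitely_supported.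
Local Open Scope classical_set_scope.
Local Open Scope ring_scope.
Context d (T : measurableType d) (R : realType) (P : probability T R).
Context (I : finType) (p : I -> R) (t : I -> T).
Hypothesis p0 : forall i, 0 <= p i.
Hypothesis integral_P : forall f : T -> \bar R,
  measurable_fun setT f -> (forall x, 0 <= f x)%E ->
  (\int[P]_x f x = \sum_i (p i)%:E * f (t i))%E.

Lemma integrable_finsupp (f : T -> R) : measurable_fun setT f ->
  P.-integrable setT (EFin \o f).
Proof.
move=> mf; have mEf : measurable_fun setT (EFin \o f) by exact/measurable_EFinP.
apply/integrableP; split => //; rewrite integral_P//; last first.
  exact: measurableT_comp.
by under eq_bigr do rewrite /= -EFinM; rewrite sumEFin ltry.
Qed.

(** [integral_P] covers nonnegative functions only, hence the split into positive and negative
    parts. *)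
Lemma expectation_finsupp (f : T -> R) : measurable_fun setT f ->
  ('E_P[f] = (\sum_i p i * f (t i))%:E)%E.
Proof.
move=> mf; have mEf : measurable_fun setT (EFin \o f) by exact/measurable_EFinP.
rewrite unlock integralE !integral_P//; last 2 first.
  exact: measurable_funeneg.
  exact: measurable_funepos.
under eq_bigr do rewrite funeposE /= -EFin_max -EFinM.
under [X in (_ - X)%E]eq_bigr do rewrite funenegE /= -EFin_max -EFinM.
rewrite !sumEFin -EFinB -sumrB; congr EFin; apply: eq_bigr => i _.
by rewrite -mulrBr; congr (_ * _); case: (leP (f (t i)) 0);
  case: (leP (- f (t i)) 0); lra.
Qed.

(** Tonelli, peeling off one sample at a time. *)
Lemma integral_iid n (f : n.-tuple T -> \bar R) : measurable_fun setT f ->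
    (forall x, 0 <= f x)%E ->
  (\int[iid P n]_x f x =
   \sum_(y : n.-tuple I) (\prod_(i < n) p (tnth y i))%:E * f (map_tuple t y))%E.
Proof.
elim: n f => [|n IH] f mf f0.
  rewrite /= integral_dirac// diracT mul1e (big_pred1 [tuple])/=; last first.
    by move=> y; apply/esym/eqP; rewrite tuple0 [RHS]tuple0.
  by rewrite big_ord0 mul1e; congr f; exact/val_inj.
rewrite [iid _ _]/= ge0_integral_distribution//.
have mfc : measurable_fun setT (f \o @consT d T n).
  by apply: measurableT_comp => //; exact: measurable_consT.
rewrite fubini_tonelli1//= integral_P//; last 2 first.
- have mF := @measurable_fun_fubini_tonelli_F _ _ _ _ _ (iid P n) _ mfc (fun=> f0 _).
  exact: mF.
- by move=> x; apply: integral_ge0 => y _ /=.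
rewrite (reindex (fun q : I * n.-tuple I => [tuple of q.1 :: q.2]))/=; last first.
  exists (fun y => (thead y, [tuple of behead y])) => [[i y]|y] _ /=.
    by congr (_, _); exact/val_inj.
  by rewrite -tuple_eta.
rewrite -(pair_bigA _ (fun i (y : n.-tuple I) =>
  (\prod_(j < n.+1) p (tnth [tuple of i :: y] j))%:E *
  f (map_tuple t [tuple of i :: y]))%E)/=.
apply: eq_bigr => i _; rewrite /fubini_F IH; last 2 first.
- exact: (measurableT_comp mfc (measurable_pair1 (t i))).
- by move=> y; exact: f0.
rewrite ge0_sume_distrr; last first.
  by move=> y _; rewrite mule_ge0 ?lee_fin ?prodr_ge0//; exact: f0.
apply: eq_bigr => y _; rewrite big_ord_recl tnth0 EFinM -muleA.
congr (_ * (_ * _))%E.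
  by congr EFin; apply: eq_bigr => j _; rewrite tnthS.
by congr f; exact/val_inj.
Qed.

End finitely_supported.

(** Currying: [reads] wants one table of bits indexed by sample and node, [iid] a tuple of
    samples. *)
Definition unpair {B J : finType} n (x : {ffun 'I_n * J -> B}) :
  n.-tuple {ffun J -> B} := [tuple [ffun j => x (i, j)] | i < n].

Lemma unpair_bij (B J : finType) n : bijective (@unpair B J n).
Proof.
exists (fun y : n.-tuple {ffun J -> B} =>
  [ffun v : 'I_n * J => tnth y v.1 v.2]) => [x|y].
  by apply/ffunP => -[i j]; rewrite ffunE tnth_mktuple ffunE.
apply: eq_from_tnth => i; rewrite tnth_mktuple.
by apply/ffunP => j; rewrite !ffunE.
Qed.

Lemma prodw_unpair (R : realFieldType) (B J : finType) n (w : J -> B -> R)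
    (x : {ffun 'I_n * J -> B}) :
  \prod_(i < n) prodw w (tnth (unpair x) i) = prodw (fun v => w v.2) x.
Proof.
rewrite /prodw [RHS](eq_bigr (fun v => w v.2 (x (v.1, v.2)))); last by case.
rewrite -(pair_bigA _ (fun i j => w j (x (i, j))))/=.
apply: eq_bigr => i _; apply: eq_bigr => j _.
by rewrite tnth_mktuple ffunE.
Qed.

(** * The hard instances *)

Section hard_instance.
Local Open Scope classical_set_scope.
Local Open Scope ring_scope.
Context (R : realType) (M : nat) (s : R).
Hypothesis s1 : 1 <= s.

Let s_gt0 : 0 < s. Proof. exact: lt_le_trans s1. Qed.

Let T : measurableType _ := M.+1.-tuple bool.

Definition signal (xi : T) (j : nat) : R := if nth false xi j then s else - s.

Definition mean (k j : nat) : R := if (j <= k)%N then -1 else 1.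

(** The bias for which a value in {s, -s} has mean [mean k j]; it is a probability since
    [1 <= s]. *)
Definition bit_weight k (j : 'I_M.+1) : bool -> R := bias (mean k j / s).

Definition bits (x : {ffun 'I_M.+1 -> bool}) : T := [tuple x j | j < M.+1].

Lemma norm_mean k j : `|mean k j| = 1.
Proof. by rewrite /mean; case: ifP; rewrite ?normrN normr1. Qed.

Lemma norm_signal xi j : `|signal xi j| = s.
Proof. by rewrite /signal; case: ifP; rewrite ?normrN gtr0_norm. Qed.

Lemma signal_bits x (j : 'I_M.+1) :
  signal (bits x) j = if x j then s else - s.
Proof. by rewrite /signal nth_mktuple. Qed.

Lemma bit_weight_ge0 k j b : 0 <= bit_weight k j b.
Proof.
apply: bias_ge0; rewrite -ler_norml normrM norm_mean mul1r normfV.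
by rewrite gtr0_norm ?invf_le1.
Qed.

Lemma sum_bit_weight k j : \sum_b bit_weight k j b = 1.
Proof. exact: sum_bias. Qed.

Lemma prodw_bit_weight_ge0 k x : 0 <= prodw (bit_weight k) x.
Proof. by apply: prodw_ge0; exact: bit_weight_ge0. Qed.

Definition bit_law_atoms k : seq ({nonneg R} * T) :=
  [seq (NngNum (prodw_bit_weight_ge0 k x), bits x) |
    x <- enum {ffun 'I_M.+1 -> bool}].

Lemma bit_law_atoms1 k : \sum_(q <- bit_law_atoms k) q.1%:num = 1.
Proof.
rewrite big_map big_enum/=; apply: sum_prodw; exact: sum_bit_weight.
Qed.

Definition bit_law k : probability T R := finite_law (bit_law_atoms1 k).

Lemma integral_bit_law k (f : T -> \bar R) :
  measurable_fun setT f -> (forall x, 0 <= f x)%E ->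
  (\int[bit_law k]_x f x =
   \sum_x (prodw (bit_weight k) x)%:E * f (bits x))%E.
Proof.
by move=> mf f0; rewrite integral_finite_measure_of// big_map big_enum.
Qed.

(** Adding the mean operator back leaves the interpolated signal, so that [k] influences the oracle
    only through the law of [xi]. *)
Definition hard_noise k (xi : T) (z : real_line R) : real_line R :=
  interp M (signal xi) z - interp M (mean k) z.

Definition hard_instance k : instance (real_line R) :=
  @Instance R (real_line R) (interp M (mean k)) (fun=> [set 0]) 0 _ T
    (bit_law k) (hard_noise k).

(** [mean k] jumps only between [k] and [k.+1], so a single ramp survives. *)
Lemma interp_mean k z : (k < M)%N -> interp M (mean k) z = -1 + 2 * ramp k z.
Proof.
move=> kM; rewrite /interp (bigD1 (Ordinal kM))//= big1 => [|i ik].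
  by rewrite /mean leqnn ltnn leq0n; ring.
have {}ik : (i != k :> nat) by rewrite -(inj_eq val_inj) in ik.
rewrite /mean; case: (ltngtP i k) ik => // ik _.
  by rewrite subrr mul0r.
by rewrite subrr mul0r.
Qed.

Lemma measurable_interp d (S : measurableType d) (c : nat -> S -> R)
    (Z : S -> R) : (forall j, measurable_fun setT (c j)) ->
  measurable_fun setT Z ->
  measurable_fun setT (fun w => interp M (c^~ w) (Z w)).
Proof.
move=> mc mZ; apply: measurable_funD => //.
apply: measurable_sum => i; apply: measurable_funM.
  exact: measurable_funB.
apply: measurable_minr => //; apply: measurable_maxr => //.
exact: measurable_funB.
Qed.

Lemma measurable_signal j : measurable_fun setT (signal^~ j).
Proof.
apply: measurable_fun_ifT => //.
have [jM|Mj] := ltnP j M.+1; last first.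
  rewrite (_ : (fun _ => _) = cst false) => [|].
    exact: measurable_cst.
  by apply/funext => x /=; rewrite nth_default// size_tuple.
rewrite (_ : (fun _ => _) = (@tnth _ bool)^~ (Ordinal jM)); last first.
  by apply/funext => x /=; rewrite (tnth_nth false).
exact: measurable_tnth.
Qed.

Lemma measurable_hard_noise k z : measurable_fun setT (hard_noise k ^~ z : T -> R).
Proof.
apply: measurable_funB; last exact: measurable_cst.
exact: (measurable_interp measurable_signal (measurable_cst z)).
Qed.

Lemma norm_hard_noise k xi z : `|hard_noise k xi z| <= 2 * s.
Proof.
apply: le_trans (ler_normB _ _) _; rewrite mulr2n mulrDl mul1r.
apply: lerD; apply: norm_interp => j; rewrite ?norm_signal//.
by rewrite norm_mean.
Qed.

Lemma hard_noise_lipschitz k xi x y :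
  `|hard_noise k xi x - hard_noise k xi y| <= (4 * s) *+ M * `|x - y|.
Proof.
rewrite /hard_noise !interpB.
have -> : 4 * s = (2 * s) *+ 2 by ring.
apply: interp_lipschitz => j; apply: le_trans (ler_normB _ _) _.
by rewrite norm_signal norm_mean; move: s1; lra.
Qed.

Lemma mean_hard_noise k z :
  \sum_x prodw (bit_weight k) x * hard_noise k (bits x) z = 0.
Proof.
have [i [j [t [_ E]]]] := interp_local M z.
have m l : wsum (bit_weight k) (fun x => signal (bits x) (l : 'I_M.+1)) =
    mean k l.
  transitivity (\sum_b bit_weight k l b * (if b then s else - s)).
    rewrite -(wsum_coord _ (fun b => if b then s else - s)); last first.
      exact: sum_bit_weight.
    by apply: eq_bigr => x _; rewrite signal_bits.
  by rewrite big_bool /bit_weight /bias/=; field; exact: lt0r_neq0.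
under eq_bigr do rewrite /hard_noise interpB E.
transitivity ((1 - t) * (wsum (bit_weight k) (fun x => signal (bits x) i)
    - wsum (bit_weight k) (fun=> mean k i)) +
  t * (wsum (bit_weight k) (fun x => signal (bits x) j)
    - wsum (bit_weight k) (fun=> mean k j))).
  rewrite /wsum -!sumrB !mulr_sumr -big_split/=.
  by apply: eq_bigr => x _; ring.
rewrite !m /wsum -!mulr_suml sum_prodw; last exact: sum_bit_weight.
by ring.
Qed.

End hard_instance.

Section zero_operator.
Local Open Scope classical_set_scope.
Local Open Scope ring_scope.

Lemma maximally_monotone0 (R : realType) :
  maximally_monotone (fun=> [set 0] : set (real_line R)).
Proof.
split=> [x y _ _ -> ->|B mB AB x u Bxu].
  by rewrite subrr linear0l.
(* Testing [u] in B(x) against 0 in B(x + u) gives - u^2 >= 0. *)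
have := mB x (x + u) u 0 Bxu (AB _ _ erefl).
rewrite /inner/= /mulR subr0 opprD addrA subrr sub0r mulrN oppr_ge0 => u0.
by apply/eqP; rewrite -sqrf_eq0 eq_le sqr_ge0 andbT.
Qed.

Lemma residual0 (R : realType) (F : real_line R -> real_line R) z :
  residual F (fun=> [set 0]) z = `|F z|%:E.
Proof. by rewrite /residual image_set1 addr0 ereal_inf1. Qed.

End zero_operator.

Section hard_instance_properties.
Local Open Scope classical_set_scope.
Local Open Scope ring_scope.
Context (R : realType) (M : nat) (s : R).
Hypothesis s1 : 1 <= s.
Local Notation H := (real_line R).
Local Notation I := (hard_instance M s1).

Lemma admissible_hard_instance k : (k < M)%N ->
  admissible 2 M%:R (2 * s) ((4 * s) *+ M) (I k).
Proof.
move=> kM; have M0 : (0 < M)%N by exact: leq_ltn_trans kM.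
have s0 : 0 < s by exact: lt_le_trans s1.
have mop x y : interp M (mean R k) x - interp M (mean R k) y =
    2 * (ramp k x - ramp k y) by rewrite !interp_mean//; ring.
have lawE := @integral_bit_law R M s s1 k.
split.
- split; rewrite ?ltr0n//; first by rewrite mulr_ge0// ltW.
  by rewrite mulrn_wge0// mulr_ge0// ltW.
- split=> [x y|].
    by rewrite /inner/= /mulR mop -mulrA mulr_ge0// ramp_monotone.
  move=> [x y] _ /=; rewrite mop normrM ger0_norm// ler_wpM2l//.
  exact: ramp_lipschitz.
- exact: maximally_monotone0.
(* The centre of the cell solves the inclusion; it lies within [M] of the starting point 0. *)
exists (k%:R + 2^-1 : R); split.
- exists 0 => //=; rewrite addr0 interp_mean// ramp_mid; first by field.
  by rewrite -[k.+1%:R]natr1; lra.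
- rewrite sub0r normrN ger0_norm; last by rewrite addr_ge0.
  have : k.+1%:R <= M%:R :> R by rewrite ler_nat.
  by rewrite -[k.+1%:R]natr1; lra.
split.
- move=> d S Z /random_vector_real mZ; apply/random_vector_real.
  have mZ1 : measurable_fun setT (fun w : S * M.+1.-tuple bool => Z w.1 : R).
    exact: (measurableT_comp mZ).
  apply: measurable_funB.
    apply: (@measurable_interp R M _ _ (fun j w => signal s w.2 j) _) => // j.
    exact: (measurableT_comp (measurable_signal s j) measurable_snd).
  exact: (@measurable_interp R M _ _ (fun j _ => mean R k j) _).
- move=> z h; have mz : measurable_fun setT
      (fun xi : M.+1.-tuple bool => inner h (hard_noise s k xi z : H) : R).
    rewrite /inner/= /mulR.
    by apply: measurable_funM => //; exact: measurable_hard_noise.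
  split; first exact: (integrable_finsupp lawE).
  rewrite (expectation_finsupp lawE)//= linear0r; congr EFin.
  transitivity (h * \sum_(x : {ffun 'I_M.+1 -> bool})
      prodw (bit_weight s k) x * hard_noise s k (bits x) z).
    by rewrite mulr_sumr; apply: eq_bigr => x _; rewrite /inner/= /mulR mulrCA.
  by rewrite mean_hard_noise ?mulr0.
- move=> z; have mz : measurable_fun setT
      (fun xi : M.+1.-tuple bool => `|hard_noise s k xi z : H| ^+ 2 : R).
    apply: measurable_funX; apply: measurableT_comp => //.
    exact: measurable_hard_noise.
  rewrite (expectation_finsupp lawE)// lee_fin.
  apply: sum_prodw_le => [v b|v|x]; rewrite ?sum_bit_weight ?bit_weight_ge0//.
  rewrite ler_pXn2r ?nnegrE//; last by rewrite mulr_ge0// ltW.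
  exact: norm_hard_noise.
- move=> y z; have mz : measurable_fun setT
      (fun xi : M.+1.-tuple bool =>
        `|(hard_noise s k xi y - hard_noise s k xi z) : H| ^+ 2 : R).
    apply: measurable_funX; apply: measurableT_comp => //.
    by apply: measurable_funB; exact: measurable_hard_noise.
  rewrite (expectation_finsupp lawE)// lee_fin -exprMn.
  apply: sum_prodw_le => [v b|v|x]; rewrite ?sum_bit_weight ?bit_weight_ge0//.
  rewrite ler_pXn2r ?nnegrE//; last first.
    by rewrite mulr_ge0// mulrn_wge0// mulr_ge0// ltW.
  exact: hard_noise_lipschitz.
Qed.

End hard_instance_properties.

(** * The lower bound *)

Section lower_bound.
Local Open Scope classical_set_scope.
Local Open Scope ring_scope.
Context (R : realType) (M : nat) (s : R).
Hypothesis s1 : 1 <= s.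
Local Notation H := (real_line R).
Local Notation I := (hard_instance M s1).

(* The coordinate (i, j) of x is the random bit at node j of sample i. *)
Definition samples n (x : {ffun 'I_n * 'I_M.+1 -> bool}) :
  n.-tuple (M.+1.-tuple bool) := map_tuple (@bits M) (unpair x).

Lemma oracle_hard_instance k (xi : sample (I k)) z :
  oracle xi z = interp M (signal s xi) z.
Proof. by rewrite /oracle/= /hard_noise addrC subrK. Qed.

Variables (a : algorithm H) (N n : nat) (n0 : (0 < n)%N).

(** With seed and samples fixed, a run depends on the instance only through oracle values, and these
    do not involve [k]. *)
Lemma output_hard_instance k u xis :
  @output R H a N (I k) n (u, xis) =
  @output R H a N (I 0) n (u, xis).
Proof.
rewrite /output /run; congr answer; apply: eq_iter => st /=.
rewrite /step; case: ifP => // _; case: decide => // i z /=.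
by rewrite !oracle_hard_instance.
Qed.

Lemma reads_output k u (h : H -> R) :
  reads n.*2 (fun x => h (@output R H a N (I k) n (u, samples x))).
Proof.
rewrite /output /run /=.
apply: (@reads_iter _ _ _ _ (fun x => @step R H a N (I k) u (samples x))
  (fun st => h (answer u st))) => st.
(* A dummy coordinate, read when the step needs no bit; it exists because [n] is positive. *)
pose v0 : 'I_n * 'I_M.+1 := (Ordinal n0, ord0).
rewrite /step; case: (size (past st) == N).
  by exists v0, v0, (fun _ _ => st).
case: (decide u st) => [i z|]; last first.
  by exists v0, v0, (fun _ _ =>
    State (sampled st) (rcons (past st) (current st)) [::]).
set j := minn _ _.
pose G v := State (maxn (sampled st) j.+1) (past st)
           (rcons (current st) (Observation j z v)).
have [jn|nj] := ltnP j n; last first.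
  (* [st] is arbitrary, so [j] may exceed the available samples; [nth] then returns its default,
     whatever [x] is. *)
  exists v0, v0, (fun _ _ => G (oracle (point : sample (I k)) z)) => x.
  by rewrite /G nth_default// size_tuple.
have [i1 [i2 [t [_ E]]]] := interp_local M z.
exists (Ordinal jn, i1), (Ordinal jn, i2), (fun b1 b2 => G
  ((1 - t) * (if b1 then s else - s) + t * (if b2 then s else - s))) => x.
rewrite oracle_hard_instance E.
have -> : nth point (samples x) j = bits [ffun l => x (Ordinal jn, l)].
  rewrite (nth_map [ffun=> false]) ?size_tuple//.
  by rewrite -(tnth_nth _ _ (Ordinal jn)) tnth_mktuple.
by rewrite !signal_bits !ffunE.
Qed.

Definition hard_sq_residual k (w : seed a * n.-tuple (M.+1.-tuple bool)) : R :=
  `|op (I k) (@output R H a N (I k) n w)| ^+ 2.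

(** The risk given the seed, a finite sum over bit tables; the seed is integrated last. *)
Definition seed_risk k (u : seed a) : R :=
  wsum (fun v : 'I_n * 'I_M.+1 => bit_weight s k v.2)
    (fun x => hard_sq_residual k (u, samples x)).

Section measurable_output.
Variables (k : nat) (mo : random_vector (@output R H a N (I k) n)).

Let mf : measurable_fun setT (EFin \o hard_sq_residual k).
Proof.
have /random_vector_real mout := mo.
apply/measurable_EFinP/measurable_funX; apply: measurableT_comp => //.
exact: (@measurable_interp R M _ _ (fun j _ => mean R k j) _).
Qed.

Let f0 w : (0 <= (EFin \o hard_sq_residual k) w)%E.
Proof. by rewrite lee_fin sqr_ge0. Qed.

Let fubini_FE u :
  fubini_F (iid (bit_law M s1 k) n) (EFin \o hard_sq_residual k) u =
  (seed_risk k u)%:E.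
Proof.
rewrite /fubini_F (integral_iid _ (@integral_bit_law R M s s1 k)); last 3 first.
- exact: prodw_bit_weight_ge0.
- exact: (measurableT_comp mf (measurable_pair1 u)).
- by move=> x; exact: f0.
rewrite (reindex (@unpair bool 'I_M.+1 n))/=; last exact/onW_bij/unpair_bij.
under eq_bigr do rewrite prodw_unpair -EFinM.
by rewrite sumEFin.
Qed.

(** It is the inner integral of Tonelli's theorem. *)
Lemma measurable_seed_risk : measurable_fun setT (fun u => (seed_risk k u)%:E).
Proof.
rewrite (_ : (fun u => _) = fubini_F (iid (bit_law M s1 k) n)
    (EFin \o hard_sq_residual k)); last first.
  by apply/funext => u; rewrite fubini_FE.
exact: (@measurable_fun_fubini_tonelli_F _ _ _ _ _ (iid (bit_law M s1 k) n) _
  mf f0).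
Qed.

Lemma mean_sq_residual_hard_instance :
  (mean_sq_residual a N (I k) n = \int[seed_law a]_u (seed_risk k u)%:E)%E.
Proof.
rewrite /mean_sq_residual (eq_integral (EFin \o hard_sq_residual k)) => [|w _].
  rewrite fubini_tonelli1//=.
  by apply: eq_integral => u _; rewrite fubini_FE.
by rewrite residual0 -EFin_expe.
Qed.

End measurable_output.

Lemma seed_risk_ge0 k u : 0 <= seed_risk k u.
Proof.
apply: sumr_ge0 => x _; rewrite mulr_ge0 ?sqr_ge0// prodw_ge0// => v b.
exact: bit_weight_ge0.
Qed.

(** An answer is acceptable under [k] if it lies in the open cell; otherwise its squared residual is
    1. The answer [ans] is the same function of the bits under all hypotheses. *)
Lemma sum_seed_risk_ge u : (1 + s ^- 2) ^+ n.*2 <= M%:R / 4 ->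
  M%:R / 2 <= \sum_(k < M) seed_risk k u.
Proof.
move=> sM.
pose ans x : R := @output R H a N (I 0) n (u, samples x).
pose g (k : 'I_M) x : R := (k%:R < ans x < k.+1%:R)%R%:R.
pose w k (v : 'I_n * 'I_M.+1) := bit_weight s (nat_of_ord (k : 'I_M)) v.2.
have s0 : 0 < s by exact: lt_le_trans s1.
apply: (@le_trans _ _ (\sum_k wsum (w k) (fun x => 1 - g k x))).
  apply: (@exclusive_hypotheses _ _ _ _ n.*2 (1 + s ^- 2) _ (fun=> bias 0)).
  - by rewrite lerDl invr_ge0 exprn_ge0// ltW.
  - move=> k; apply: chi2_le_bias => v.
    by rewrite exprMn exprVn -real_normK ?num_real// norm_mean expr1n mul1r.
  - move=> k; exact: (reads_output 0 u (fun z : R => (k%:R < z < k.+1%:R)%R%:R)).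
  - by move=> k x; rewrite /g; case: (_ < _ < _); rewrite ?expr1n ?expr0n.
  - by move=> x; exact: sum_open_cells_le1.
  - exact: sM.
apply: ler_sum => k _; apply: ler_sum => x _; rewrite ler_wpM2l//.
  by apply: prodw_ge0 => v b; exact: bit_weight_ge0.
rewrite /hard_sq_residual output_hard_instance /= -/(ans x) interp_mean//.
rewrite real_normK ?num_real// /g.
have [kz|zk] := leP (ans x) k%:R.
  by rewrite /= subr0 ramp0//; lra.
have [zk1|kz1] := ltP (ans x) k.+1%:R.
  by rewrite /= subrr sqr_ge0.
by rewrite /= subr0 ramp1//; lra.
Qed.

(** The sum over [k] moves inside the integral over seeds, because only the summed risk is bounded
    below for each seed. *)
Lemma hard_instance_lower_bound :
  (forall k, (k < M)%N -> random_vector (@output R H a N (I k) n)) ->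
  (1 + s ^- 2) ^+ n.*2 <= M%:R / 4 ->
  ((M%:R / 2)%:E <= \sum_(k < M) mean_sq_residual a N (I k) n)%E.
Proof.
move=> mo sM.
rewrite (eq_bigr (fun k : 'I_M => \int[seed_law a]_u (seed_risk k u)%:E)%E)
    => [|k _]; last exact: (mean_sq_residual_hard_instance (mo k (ltn_ord k))).
rewrite -(@ge0_integral_sum _ _ _ _ setT _ _
  (fun (k : 'I_M) u => (seed_risk k u)%:E))//; last 2 first.
- by move=> k; apply: measurable_seed_risk; exact: mo.
- by move=> k u _; rewrite lee_fin seed_risk_ge0.
rewrite -[leLHS]mule1 -(@probability_setT _ _ _ (seed_law a)) -integral_cst//.
apply: ge0_le_integral => //=.
- apply: emeasurable_sum => k; apply: measurable_seed_risk; exact: mo.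
- by move=> u _; rewrite sumEFin lee_fin sum_seed_risk_ge.
Qed.

End lower_bound.

(** * Choice of the parameters and conclusion *)

Lemma exists_hard_parameters (R : realType) (p C : R) (r : nat) :
  0 <= p < 1 -> 0 < C ->
  exists N M (s : R), [/\ (2 <= N)%N, (0 < M)%N, 1 <= s,
    (1 + s ^- 2) ^+ (N * r.+1).*2 <= M%:R / 4 &
    C * (2 ^+ 2 * M%:R ^+ 2 / N%:R ^+ 2
         + (2 * s) ^+ 2 * (ln N%:R `^ p) / N%:R) < 1 / 2].
Proof.
move=> /andP[p0 p1] C0.
(* N = (q K)^2 and M = q K^2: the size of q makes M / N = 1 / q small, then
   the size of K makes (ln N)^(p - 1) small. *)
pose A : R := 64 * C * r.+1%:R.
have A0 : 0 < A by rewrite !mulr_gt0// ltr0n.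
pose q := (Num.truncn (32 * C)).+1.
have Cq : 32 * C <= q%:R ^+ 2.
  have : 32 * C < q%:R by rewrite truncnS_gt.
  have : 1 <= q%:R :> R by rewrite ler1n.
  by nra.
(* Large enough that (ln N)^(1 - p) >= A; the summand 4 pays for the denominator in [M%:R / 4]. *)
pose K := (Num.truncn (expR (A `^ (1 - p)^-1)) + 4)%N.
have K4 : (4 <= K)%N by rewrite leq_addl.
have AK : expR (A `^ (1 - p)^-1) <= K%:R.
  apply: le_trans (ltW (truncnS_gt _)) _.
  by rewrite ler_nat -[in leqLHS]addn1 leq_add2l.
have q0 : 0 < q%:R :> R by rewrite ltr0n.
have K0 : 0 < K%:R :> R by rewrite ltr0n (leq_trans _ K4).
pose N := ((q * K) ^ 2)%N.
have qK4 : (4 <= q * K)%N by rewrite (leq_trans K4)// leq_pmull.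
have NE : N%:R = (q%:R * K%:R) ^+ 2 :> R by rewrite natrX natrM.
have N0 : 0 < N%:R :> R by rewrite NE exprn_gt0// mulr_gt0.
pose l : R := ln N%:R.
have lE : l = 2 * ln (q%:R * K%:R).
  by rewrite /l NE lnXn ?mulr_gt0// mulr2n mulrDl mul1r.
have Al : A `^ (1 - p)^-1 <= l.
  have h : A `^ (1 - p)^-1 <= ln (q%:R * K%:R).
    rewrite -ler_expR lnK ?posrE ?mulr_gt0// (le_trans AK)//.
    by rewrite ler_peMl ?ler1n// ltW.
  have := powR_ge0 A (1 - p)^-1; rewrite lE; lra.
have l0 : 0 < l by exact: lt_le_trans (powR_gt0 _ A0) Al.
have Alp : A * l `^ p <= l.
  have A1 : A <= l `^ (1 - p).
    have {1}-> : A = (A `^ (1 - p)^-1) `^ (1 - p).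
      by rewrite -powRrM mulVf ?powRr1 ?ltW// gt_eqF ?subr_gt0.
    by rewrite ge0_ler_powR ?nnegrE ?powR_ge0 ?subr_ge0// ltW.
  have {2}-> : l = l `^ (1 - p) * l `^ p.
    by rewrite -powRD ?subrK ?powRr1 ?ltW ?oner_eq0.
  by rewrite ler_wpM2r ?powR_ge0.
(* The square of [s], chosen so that the number 2 N (r + 1) of bits read, divided by [s2], is half
   of ln N. *)
pose s2 : R := 4 * r.+1%:R * N%:R / l.
have r1 : 1 <= r.+1%:R :> R by rewrite ler1n.
have s21 : 1 <= s2.
  rewrite ler_pdivlMr// mul1r.
  have := @ln_sublinear R N%:R N0; rewrite -/l => lN; nra.
have s20 : 0 < s2 by exact: lt_le_trans s21.
exists N, (q * K ^ 2)%N, (Num.sqrt s2); split.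
- by rewrite /N (@leq_trans (4 ^ 2)%N)// leq_sqr.
- by rewrite muln_gt0/= expn_gt0 (leq_trans _ K4).
- by rewrite -[leLHS]sqrtr1 ler_sqrt// ltW.
- rewrite sqr_sqrtr; last exact: ltW.
  (* By 1 + x <= exp x the power is at most exp(ln N / 2) = q K, which is at most M / 4 = q K^2 / 4
     as [4 <= K]. *)
  apply: (@le_trans _ _ (expR s2^-1 ^+ (N * r.+1).*2)).
    by rewrite lerXn2r ?nnegrE ?expR_ge0 ?expR_ge1Dx// addr_ge0 ?invr_ge0 ?ltW.
  rewrite -expRM_natl.
  have -> : ((N * r.+1).*2)%:R * s2^-1 = ln (q%:R * K%:R) :> R.
    have -> : ln (q%:R * K%:R) = l / 2 by rewrite lE; field.
    rewrite -muln2 !natrM /s2 NE; field.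
    by rewrite (gt_eqF l0) (gt_eqF K0) (gt_eqF q0) nat1r pnatr_eq0.
  rewrite lnK ?posrE ?mulr_gt0// natrM natrX.
  rewrite ler_pdivlMr// -mulrA ler_wpM2l ?(ltW q0)// expr2.
  by rewrite ler_wpM2l ?(ltW K0)// ler_nat.
- rewrite exprMn sqr_sqrtr; last exact: ltW.
  rewrite -/l.
  have -> : C * (2 ^+ 2 * (q * K ^ 2)%:R ^+ 2 / N%:R ^+ 2 +
      2 ^+ 2 * s2 * l `^ p / N%:R) =
    4 * C / q%:R ^+ 2 + A * l `^ p / l / 4.
    rewrite /s2 /A NE natrM natrX; field.
    by rewrite (gt_eqF l0) (gt_eqF K0) (gt_eqF q0).
  have h1 : 4 * C / q%:R ^+ 2 <= 1 / 8.
    by rewrite ler_pdivrMr ?exprn_gt0//; lra.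
  have h2 : A * l `^ p / l <= 1 by rewrite ler_pdivrMr ?mul1r.
  by lra.
Qed.

(* In a method with at most r queries per iteration, N iterations take at most
   N * r.+1 steps: the queries, and the end of each iteration. *)
Theorem corollary5p2 (R : realType) (p : R) : 0 <= p < 1 ->
  ~ exists (M : method R) (r : nat),
      [/\ measurable_method M, fixed_query M r &
       exists2 C : R, 0 < C &
         forall (L D sigma LDelta : R) (H : hilbert R) (I : instance H),
           admissible L D sigma LDelta I ->
         forall N : nat, (2 <= N)%N ->
           (mean_sq_residual (instantiate M I L D sigma LDelta N) N I (N * r.+1)
            <= (C * (L ^+ 2 * D ^+ 2 / N%:R ^+ 2
                     + sigma ^+ 2 * (ln N%:R `^ p) / N%:R))%:E)%E].
Proof.
move=> p01 [meth [r [mmeth _ [C C0 bound]]]].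
have [N [M [s [N2 M0 s1 sM CM]]]] := exists_hard_parameters r p01 C0.
have adm k := @admissible_hard_instance R M s s1 k.
(* The method sees only the parameters, the starting point and the resolvents,
   which do not depend on the hypothesis. *)
pose a := instantiate meth (hard_instance M s1 0) 2 M%:R (2 * s)
  ((4 * s) *+ M) N.
have n0 : (0 < N * r.+1)%N by rewrite muln_gt0 (leq_trans _ N2).
have := @hard_instance_lower_bound R M s s1 a N (N * r.+1) n0
  (fun k kM => mmeth _ _ _ _ _ _ (adm k kM) N (N * r.+1)%N) sM.
apply/negP; rewrite -ltNge.
set b := C * _ in CM.
(* Under each of the [M] hypotheses the claimed bound is [b] < 1/2, so the sum stays below M / 2. *)
apply: (@le_lt_trans _ _ (\sum_(k < M) b%:E)%E).
  apply: lee_sum => k _; exact: (bound _ _ _ _ _ _ (adm k (ltn_ord k)) N N2).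
rewrite sumEFin lte_fin sumr_const card_ord -mulr_natl.
have : 0 < M%:R :> R by rewrite ltr0n.
by nra.
Qed.
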